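(* Let $\psi = \sum_{i=1}^{\infty} 1/F_i$ be the reciprocal Fibonacci constant. Then, as $n\to\infty$, $$\psi - \sum_{i=1}^{n} \frac{1}{F_i} = \sqrt{5}\,\alpha\cdot\alpha^{-n} + \frac{\sqrt5}{2\alpha^2}\cdot(-1)^{n+1}\cdot\alpha^{-3n} + O(\alpha^{-5n}),$$ where $\sqrt5\,\alpha = (5+\sqrt5)/2 = \alpha^2+1$ (numerically $\approx 3.6180$) and $\sqrt5/(2\alpha^2) \approx 0.4271$ numerically.
   Context: $F_n$ ($n\ge1$) are the Fibonacci numbers: $F_1=F_2=1$, $F_n=F_{n-1}+F_{n-2}$ for $n\ge3$. $\alpha = \frac{1+\sqrt5}{2}$ is the golden ratio. *)

(* Defs.v *)
From HB Require Import structures.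
From mathcomp Require Import all_boot all_order all_algebra.
From mathcomp Require Import all_classical all_reals all_analysis.

Set Implicit Arguments.
Unset Strict Implicit.
Unset Printing Implicit Defensive.

Import Order.TTheory GRing.Theory Num.Theory.
Import numFieldNormedType.Exports.

Local Open Scope classical_set_scope.
Local Open Scope ring_scope.

(* The convention [fib 0 = 0] is compatible with F_1 = F_2 = 1; the sums below
   start at index 1, so 1 / F_0 never occurs. *)
Fixpoint fib (n : nat) : nat :=
  match n with
  | 0 => 0%N
  | 1 => 1%N
  | (m.+1 as k).+1 => (fib k + fib m)%N
  end.

Definition golden (R : realType) : R := (1 + Num.sqrt 5) / 2.

Definition fib_recip_sum (R : realType) (n : nat) : R :=
  \sum_(1 <= i < n.+1) (fib i)%:R^-1.

(* [limn] returns a default value on divergent sequences, so statements about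
   this constant should come with [cvgn (fib_recip_sum R)]. *)
Definition fib_recip (R : realType) : R := limn (fib_recip_sum R).

(* Main.v *)
Require Import Defs.
From mathcomp Require Import all_boot all_order all_algebra.
From mathcomp Require Import all_classical all_reals all_analysis.
From mathcomp Require Import ring lra.

Import Order.TTheory GRing.Theory Num.Theory.
Import numFieldNormedType.Exports.

Local Open Scope classical_set_scope.
Local Open Scope ring_scope.

(** Write [phi] for the golden ratio and, for [i > 0], let [x = phi ^- i] and
    [s = (-1) ^+ i].  Binet's formula reads
    [sqrt 5 * x = (1 - s * x ^+ 2) / F_i],
    so multiplying by [1 + s * x ^+ 2] gives the exact identity
    [1 / F_i = sqrt 5 * (x + s * x ^+ 3) + x ^+ 4 / F_i].
    The first term on the right is a combination of two geometric sequences,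
    and summing it over [i > n] gives precisely the two main terms of the
    expansion, called [fib_tail n] below: this is [fib_tail_step].

    Hence the corrected partial sums [fib_recip_sum n + fib_tail n] increase,
    with increments [phi ^- (4 * i) / F_i].  Since [F_i] is at least
    [phi ^+ i / phi ^+ 2], these increments are at most the decrements of
    [phi ^- (5 * n)], so the corrected sums with [phi ^- (5 * n)] added do
    not increase ([fib_tail_step_le]).  Two such monotone sequences trap the
    limit between them ([cvgn_enclosure]), and [fib_tail] tends to 0, so the
    limit is the reciprocal Fibonacci constant.  The error is thus
    between 0 and [phi ^- (5 * n)] for every [n], not only asymptotically. *)

(** * The golden ratio *)

Section Golden.
Variable R : realType.
Local Notation phi := (golden R).

Lemma sqrt5_golden : Num.sqrt 5 = 2 * phi - 1.
Proof. by rewrite /golden; field. Qed.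

Lemma golden_sqr : phi ^+ 2 = phi + 1.
Proof.
have s5 : Num.sqrt 5 ^+ 2 = 5 :> R by rewrite sqr_sqrtr.
by rewrite /golden expr_div_n sqrrD s5 expr2; field.
Qed.

(** The bounds are consecutive quotients of Fibonacci numbers, hence convergents
    of the continued fraction of [phi].  Convergents this far out are needed
    because the second numerical estimate of the theorem, which amounts to a
    lower bound on [phi], holds with a margin below [10 ^- 6]. *)
Lemma golden_bounds : 2584 / 1597 < phi < 1597 / 987.
Proof.
have s0 : 0 <= Num.sqrt 5 :> R by exact: sqrtr_ge0.
have := golden_sqr; have := sqrt5_golden; nra.
Qed.

Lemma golden_gt1 : 1 < phi.
Proof. by have /andP[h _] := golden_bounds; lra. Qed.

Lemma golden_gt0 : 0 < phi.
Proof. exact: lt_trans ltr01 golden_gt1. Qed.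

Lemma golden_neq0 : phi != 0.
Proof. by rewrite gt_eqF// golden_gt0. Qed.

Lemma golden_expVn_gt0 n : 0 < phi ^- n.
Proof. by rewrite invr_gt0 exprn_gt0// golden_gt0. Qed.

Lemma golden_expVnS n : phi ^- n = phi * phi ^- n.+1.
Proof. by rewrite exprS invfM mulrA divff ?mul1r// golden_neq0. Qed.

Lemma golden_expVnM k n : phi ^- (k * n) = (phi ^- n) ^+ k.
Proof. by rewrite mulnC exprM exprVn. Qed.

Lemma golden_expVn_lt1 k : (0 < k)%N -> phi ^- k < 1.
Proof.
move=> k0; rewrite invf_lt1 ?exprn_gt0 ?golden_gt0//.
by rewrite exprn_egt1 ?golden_gt1// -lt0n.
Qed.

(** * Fibonacci numbers *)

Lemma fib_binet n :
  Num.sqrt 5 * (fib n)%:R = phi ^+ n - (-1) ^+ n * phi ^- n.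
Proof.
have conjE : - phi^-1 = 1 - phi.
  apply: (mulfI golden_neq0); rewrite mulrN divff ?golden_neq0//.
  have := golden_sqr; lra.
rewrite -exprVn -exprMn mulN1r conjE sqrt5_golden.
(* Both sides satisfy the Fibonacci recurrence. *)
suff : (2 * phi - 1) * (fib n)%:R = phi ^+ n - (1 - phi) ^+ n /\
       (2 * phi - 1) * (fib n.+1)%:R = phi ^+ n.+1 - (1 - phi) ^+ n.+1.
  by case.
elim: n => [|n [IH1 IH2]]; first by split; rewrite /=; ring.
split=> //.
rewrite -[fib n.+2]/(fib n.+1 + fib n)%N natrD mulrDr IH1 IH2.
by have := golden_sqr; rewrite !exprS expr0 => h; ring: h.
Qed.

Lemma golden_expn_le_fib n : phi ^+ n <= phi * (fib n.+1)%:R.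
Proof.
suff : phi ^+ n <= phi * (fib n.+1)%:R /\
       phi ^+ n.+1 <= phi * (fib n.+2)%:R by case.
elim: n => [|n [IH1 IH2]].
  by rewrite /= expr0 expr1 mulr1; split=> //; exact: ltW golden_gt1.
split=> //.
rewrite -[fib n.+3]/(fib n.+2 + fib n.+1)%N natrD mulrDr.
have -> : phi ^+ n.+2 = phi ^+ n.+1 + phi ^+ n.
  by rewrite -addn2 exprD golden_sqr exprSr; ring.
exact: lerD.
Qed.

Lemma fibS_gt0 n : 0 < (fib n.+1)%:R :> R.
Proof.
rewrite -(pmulr_rgt0 _ golden_gt0).
by rewrite (lt_le_trans _ (golden_expn_le_fib n))// exprn_gt0// golden_gt0.
Qed.

Lemma fibV_le n : (fib n.+1)%:R^-1 <= phi ^+ 2 * phi ^- n.+1.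
Proof.
rewrite expr2 -mulrA -golden_expVnS -[leLHS]mul1r ler_pdivrMr ?fibS_gt0//.
rewrite mulrAC -[leLHS](divff (expf_neq0 n golden_neq0)).
by rewrite ler_wpM2r ?golden_expn_le_fib// ltW ?golden_expVn_gt0.
Qed.

(** * The corrected partial sums *)

Definition fib_tail n : R :=
  Num.sqrt 5 * phi * phi ^- n
  + Num.sqrt 5 / (2 * phi ^+ 2) * (-1) ^+ n.+1 * phi ^- (3 * n)%N.

Lemma cvg_fib_tail : fib_tail @ \oo --> 0.
Proof.
set c := Num.sqrt 5 / (2 * phi ^+ 2).
(* The sign is absorbed into the ratio of the second geometric sequence. *)
have -> : fib_tail =
    geometric (Num.sqrt 5 * phi) (phi ^- 1) + geometric (- c) (- phi ^- 3).
  apply/funext => n; rewrite /fib_tail -/c !fctE /= expr1 exprVn; congr (_ + _).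
  by rewrite [in RHS]exprNn exprVn -exprM exprS mulN1r mulrN mulrA !mulNr.
rewrite -[0](addr0 0); apply: cvgD; apply: cvg_geometric.
  by rewrite gtr0_norm ?golden_expVn_gt0 ?golden_expVn_lt1.
by rewrite normrN gtr0_norm ?golden_expVn_gt0 ?golden_expVn_lt1.
Qed.

(** The coefficients of [fib_tail] sum the geometric sequences because
    [phi * (phi - 1) = 1] and [phi ^+ 3 + 1 = 2 * phi ^+ 2]. *)
Lemma fib_tail_step n :
  (fib n.+1)%:R^-1 + fib_tail n.+1 - fib_tail n =
  (phi ^- n.+1) ^+ 4 * (fib n.+1)%:R^-1.
Proof.
have F0 : (fib n.+1)%:R != 0 :> R by rewrite gt_eqF ?fibS_gt0.
have p2 : phi * phi = phi + 1 by rewrite -expr2 golden_sqr.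
have ss := @sqrr_sign R n.
pose r : R := Num.sqrt 5; pose c := r / (2 * phi ^+ 2).
have rE : r = c * (phi ^+ 3 + 1).
  rewrite (_ : phi ^+ 3 + 1 = 2 * phi ^+ 2); last by ring: p2.
  by rewrite /c divfK// mulf_neq0 ?expf_neq0 ?golden_neq0// pnatr_eq0.
have rxE : r * phi ^- n.+1 =
    (1 - (-1) ^+ n.+1 * (phi ^- n.+1) ^+ 2) * (fib n.+1)%:R^-1.
  apply: (canRL (mulfK F0)); rewrite mulrAC fib_binet mulrBl expr2 mulrA.
  by rewrite divff ?expf_neq0 ?golden_neq0.
rewrite /fib_tail -/r -/c !golden_expVnM (golden_expVnS n).
move: rxE; rewrite !(exprS (-1)) !mulN1r !mulNr !opprK.
set x := phi ^- n.+1; set f := _^-1; move: ((-1) ^+ n) ss => s ss rxE.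
transitivity (f - r * x + s * x ^+ 2 * (r * x)); last by rewrite rxE; ring: ss.
transitivity (f - (phi * phi - phi) * r * x + s * x ^+ 3 * (c * (phi ^+ 3 + 1))).
  by ring.
by rewrite -rE p2; ring.
Qed.

(** By [fibV_le] the left side is at most [phi ^+ 2] times [phi ^- (5 * n.+1)],
    while the right side is [phi ^+ 5 - 1 = 5 * phi + 2] times it, and
    [phi ^+ 2 = phi + 1] is smaller. *)
Lemma fib_tail_step_le n :
  (phi ^- n.+1) ^+ 4 * (fib n.+1)%:R^-1 <= phi ^- (5 * n) - phi ^- (5 * n.+1).
Proof.
have x0 := golden_expVn_gt0 n.+1.
apply: (@le_trans _ _ ((phi ^- n.+1) ^+ 4 * (phi ^+ 2 * phi ^- n.+1))).
  by rewrite ler_wpM2l ?fibV_le// exprn_ge0// ltW.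
rewrite !golden_expVnM (golden_expVnS n).
have p5 : phi ^+ 5 = 5 * phi + 3.
  by have := golden_sqr; rewrite expr2 => h; ring: h.
have p1 := golden_gt1; have p2 := golden_sqr.
move: (phi ^- n.+1) x0 => x x0; rewrite -subr_ge0.
have -> : (phi * x) ^+ 5 - x ^+ 5 - x ^+ 4 * (phi ^+ 2 * x) =
    x ^+ 5 * (phi ^+ 5 - 1 - phi ^+ 2) by ring.
by rewrite p5 p2 mulr_ge0 ?exprn_ge0 ?(ltW x0)//; lra.
Qed.

End Golden.

(** * Enclosure of a limit *)

(** The sequence [u] is nondecreasing and [u + e] nonincreasing, and [u] stays
    below [u + e]: every value of [u + e] bounds all later values of [u], hence
    also its limit. *)
Lemma cvgn_enclosure (R : realType) (u e : nat -> R) :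
    (forall n, 0 <= e n) ->
    (forall n, 0 <= u n.+1 - u n <= e n - e n.+1) ->
  cvgn u /\ forall n, u n <= limn u <= u n + e n.
Proof.
move=> e0 ue.
have ndu : nondecreasing_seq u.
  by apply/nondecreasing_seqP => n; have /andP[h _] := ue n; rewrite -subr_ge0.
have niue : nonincreasing_seq (fun n => u n + e n).
  by apply/nonincreasing_seqP => n; have /andP[_ h] := ue n; lra.
have ub n m : (n <= m)%N -> u m <= u n + e n.
  by move=> nm; rewrite (le_trans _ (niue _ _ nm))// lerDl.
have cu : cvgn u.
  apply: nondecreasing_is_cvgn => //; exists (u 0%N + e 0%N) => _ [n _ <-].
  exact: ub.
split=> // n; rewrite nondecreasing_cvgn_le//=.
by apply: limr_le => //; near=> m; apply: ub; near: m; exact: nbhs_infty_ge.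
Unshelve. all: by end_near. Qed.

(** * The reciprocal Fibonacci constant *)

Section Expansion.
Variable R : realType.
Local Notation phi := (golden R).

Lemma fib_recip_expansion :
  cvgn (fib_recip_sum R) /\
  forall n, 0 <= fib_recip R - fib_recip_sum R n - fib_tail R n <= phi ^- (5 * n).
Proof.
pose u n := fib_recip_sum R n + fib_tail R n.
have [|n|cu encl] := @cvgn_enclosure R u (fun n => phi ^- (5 * n)).
- by move=> n; rewrite ltW ?golden_expVn_gt0.
- have -> : u n.+1 - u n = (phi ^- n.+1) ^+ 4 * (fib n.+1)%:R^-1.
    rewrite -fib_tail_step /u /fib_recip_sum [in LHS]big_nat_recr//=; ring.
  rewrite fib_tail_step_le andbT mulr_ge0 ?invr_ge0 ?ler0n//.
  by rewrite exprn_ge0// ltW ?golden_expVn_gt0.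
have cS : fib_recip_sum R @ \oo --> limn u.
  have -> : fib_recip_sum R = u - fib_tail R.
    by apply/funext => n; rewrite /u !fctE addrK.
  by rewrite -[limn u]subr0; apply: cvgB => //; exact: cvg_fib_tail.
have limE : fib_recip R = limn u by apply: cvg_lim.
split; first exact: cvgP cS.
by move=> n; rewrite limE; have := encl n; rewrite /u; lra.
Qed.

End Expansion.

Theorem proposition4p3 (R : realType) :
  [/\ cvgn (fib_recip_sum R),
      (fun n : nat => fib_recip R - fib_recip_sum R n) =
      (fun n : nat =>
         Num.sqrt 5 * golden R * golden R ^- n
         + Num.sqrt 5 / (2 * golden R ^+ 2)
           * (-1) ^+ n.+1 * golden R ^- (3 * n)%N)
      +O_\oo (fun n : nat => golden R ^- (5 * n)%N),
      Num.sqrt 5 * golden R = (5 + Num.sqrt 5) / 2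
      /\ Num.sqrt 5 * golden R = golden R ^+ 2 + 1,
      `|Num.sqrt 5 * golden R - 3618 / 10 ^+ 3| <= 1 / (2 * 10 ^+ 4) &
      `|Num.sqrt 5 / (2 * golden R ^+ 2) - 4271 / 10 ^+ 4|
        <= 1 / (2 * 10 ^+ 4)].
Proof.
have [cS encl] := fib_recip_expansion R.
have p2 := golden_sqr R; have /andP[plo phi_hi] := golden_bounds R.
have lead : Num.sqrt 5 * golden R = golden R + 2.
  by rewrite sqrt5_golden mulrBl mul1r -mulrA -expr2 p2; ring.
split=> //.
- apply/eqaddOP; exists 1; split=> // k k1; near=> n.
  have /andP[lo hi] := encl n; rewrite !fctE -/(fib_tail R n).
  rewrite ger0_norm// gtr0_norm ?golden_expVn_gt0//.
  by rewrite (le_trans hi)// ler_peMl ?(ltW k1)// ltW ?golden_expVn_gt0.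
- by rewrite lead sqrt5_golden p2; split; lra.
- by rewrite lead ler_norml; lra.
- (* Reducing by [golden_sqr] turns the quotient into a linear expression. *)
  have -> : Num.sqrt 5 / (2 * golden R ^+ 2) = 3 / 2 * golden R - 2.
    apply: (canLR (mulfK _)); first by rewrite p2 gt_eqF//; lra.
    by rewrite sqrt5_golden p2; have := p2; rewrite expr2; lra.
  by rewrite ler_norml; lra.
Unshelve. all: by end_near. Qed.
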